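(* Let $\kappa\in\mathbb{R}$ and let $(X,d)$ be a geodesic metric space which is $\mathrm{CAT}(\kappa)$. Then for every integer $n>0$ and every real number $l$ with $0<l<D_\kappa$, the magnitude homology vanishes: $MH^{l}_{n}(X)=0$.
   Context: **Geodesics.** A geodesic in a metric space $(X,d)$ is a map $\gamma\colon[0,c]\to X$ ($c\ge 0$) with $d(\gamma(s),\gamma(t))=|s-t|$ for all $s,t\in[0,c]$; it connects $\gamma(0)$ and $\gamma(c)$. $X$ is geodesic if every pair of points is connected by a geodesic. **$\mathrm{CAT}(\kappa)$.** Put $D_\kappa=\pi/\sqrt{\kappa}$ if $\kappa>0$ and $D_\kappa=+\infty$ if $\kappa\le 0$. Let $S_\kappa$ be the complete simply connected surface of constant curvature $\kappa$. A geodesic triangle $\Delta_{abc}$ in $X$ is a union $[a,b]\cup[b,c]\cup[c,a]$ of geodesics connecting three points pairwise. It is $\kappa$-small if $d(a,b)+d(b,c)+d(c,a)<2D_\kappa$. Its comparison triangle $\tilde\Delta_{abc}\subset S_\kappa$ is the geodesic triangle (unique up to congruence) with the same side lengths. The comparison point of $s\in[a,b]$ is the point $\tilde s\in[\tilde a,\tilde b]$ with $d(\tilde a,\tilde s)=d(a,s)$; similarly for the other sides. $X$ is $\mathrm{CAT}(\kappa)$ if for every $\kappa$-small geodesic triangle $\Delta_{abc}$ in $X$ and all $s,t\in\Delta_{abc}$ with comparison points $\tilde s,\tilde t$ one has $d(s,t)\le d_{S_\kappa}(\tilde s,\tilde t)$. **Magnitude homology.** For a metric space $(X,d)$, a proper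 $n$-chain is a tuple $x=(x_0,\dots,x_n)\in X^{n+1}$ with $x_i\ne x_{i+1}$ for $0\le i\le n-1$; its length is $|x|=\sum_{i=0}^{n-1}d(x_i,x_{i+1})$. Write $a\prec c\prec b$ if $d(a,b)=d(a,c)+d(c,b)$ and $c\ne a$, $c\ne b$. For a real number $l\ge 0$, $MC^l_n(X)$ is the free abelian group on proper $n$-chains of length $l$, with differential $\partial_n=\sum_{i=1}^{n-1}(-1)^i\partial^i_n$, where $\partial^i_n(x_0,\dots,x_n)=(x_0,\dots,\hat{x}_i,\dots,x_n)$ if $x_{i-1}\prec x_i\prec x_{i+1}$ and $0$ otherwise. $MH^l_n(X)$ is the $n$-th homology group of the chain complex $(MC^l_*(X),\partial_* )$. *)

(* Defs.v *)
From HB Require Import structures.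
From mathcomp Require Import all_boot all_order all_algebra.
From mathcomp Require Import all_classical all_reals all_analysis.
From mathcomp Require Import freeg.
From mathcomp Require Import zify ring lra.

Set Implicit Arguments.
Unset Strict Implicit.
Unset Printing Implicit Defensive.

Import Order.TTheory GRing.Theory Num.Theory.

Local Open Scope classical_set_scope.
Local Open Scope ring_scope.

Section Geodesics.
Context {R : realType} {T : Type}.

(* The distance is an explicit argument: these notions are used both for an
   abstract metric space and for the concrete distance of the model surface. *)
Variable d : T -> T -> R.

(* Only the restriction of gamma to [0, c] is relevant. *)
Definition geodesic (c : R) (gamma : R -> T) : Prop :=
  0 <= c /\
  forall s t, 0 <= s <= c -> 0 <= t <= c ->
    d (gamma s) (gamma t) = `|s - t|.

Definition geodesic_segment (a b : T) (S : set T) : Prop :=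
  exists c (gamma : R -> T),
    [/\ geodesic c gamma, gamma 0 = a, gamma c = b &
        S = [set gamma t | t in [set t | 0 <= t <= c]]].

(* Addition on 'I_3 is modulo 3: the sides join vertices 0-1, 1-2 and 2-0. *)
Record geodesic_triangle := GeodesicTriangle {
  vertex : 'I_3 -> T;
  side : 'I_3 -> set T;
  side_segment : forall i, geodesic_segment (vertex i) (vertex (i + 1)) (side i)
}.

Definition side_length (D : geodesic_triangle) (i : 'I_3) : R :=
  d (vertex D i) (vertex D (i + 1)).

End Geodesics.

Definition geodesic_space (R : realType) (X : metricType R) : Prop :=
  forall x y : X, exists S : set X, geodesic_segment (@mdist R X) x y S.

Section ModelSurface.
Context {R : realType}.
Variable kappa : R.

Definition arcosh (t : R) : R := ln (t + Num.sqrt (t ^+ 2 - 1)).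

(* The unit sphere, the upper sheet of the hyperboloid, or the plane z = 0. *)
Definition on_model (p : R * R * R) : bool :=
  let: (x, y, z) := p in
  if 0 < kappa then x ^+ 2 + y ^+ 2 + z ^+ 2 == 1
  else if kappa < 0 then (z ^+ 2 - x ^+ 2 - y ^+ 2 == 1) && (0 < z)
  else z == 0.

Definition model : Type := {p : R * R * R | on_model p}.

(* The angular, resp. hyperbolic, distance is rescaled so that the curvature
   is kappa rather than 1, resp. -1. *)
Definition model_dist (p q : model) : R :=
  let: (x1, y1, z1) := val p in
  let: (x2, y2, z2) := val q in
  if 0 < kappa then acos (x1 * x2 + y1 * y2 + z1 * z2) / Num.sqrt kappa
  else if kappa < 0 then
    arcosh (z1 * z2 - x1 * x2 - y1 * y2) / Num.sqrt (- kappa)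
  else Num.sqrt ((x1 - x2) ^+ 2 + (y1 - y2) ^+ 2).

Definition model_diam : \bar R :=
  if 0 < kappa then (pi / Num.sqrt kappa)%:E else +oo%E.

End ModelSurface.

Section CAT.
Context {R : realType}.
Variables (kappa : R) (X : metricType R).

Definition small_triangle (D : geodesic_triangle (@mdist R X)) : Prop :=
  ((\sum_i side_length D i)%:E < 2%:E * model_diam kappa)%E.

Definition comparison_triangle (D : geodesic_triangle (@mdist R X))
    (D' : geodesic_triangle (@model_dist R kappa)) : Prop :=
  forall i, side_length D' i = side_length D i.

Definition comparison_point (D : geodesic_triangle (@mdist R X))
    (D' : geodesic_triangle (@model_dist R kappa))
    (s : X) (s' : model kappa) : Prop :=
  exists i, [/\ side D i s, side D' i s' &
                model_dist (vertex D' i) s' = mdist (vertex D i) s].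

Definition CAT : Prop :=
  forall D : geodesic_triangle (@mdist R X), small_triangle D ->
  forall D' : geodesic_triangle (@model_dist R kappa),
    comparison_triangle D D' ->
  forall (s t : X) (s' t' : model kappa),
    comparison_point D D' s s' -> comparison_point D D' t t' ->
    mdist s t <= model_dist s' t'.

End CAT.

Section MagnitudeHomology.
Context {R : realType}.
Variables (X : metricType R) (l : R).

Definition strictly_between (a c b : X) : bool :=
  [&& mdist a b == mdist a c + mdist c b, c != a & c != b].

(* A tuple (x_0, ..., x_n) is a finite function on 'I_n.+1, and its entry x_i
   is x (inord i). *)
Definition tuple_length n (x : {ffun 'I_n.+1 -> X}) : R :=
  \sum_(i < n) mdist (x (inord i)) (x (inord i.+1)).

Definition proper_of_length n : pred {ffun 'I_n.+1 -> X} :=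
  fun x => [forall i : 'I_n, x (inord i) != x (inord i.+1)] &&
           (tuple_length x == l).

Record chain n := Chain {
  chain_val :> {ffun 'I_n.+1 -> X};
  _ : proper_of_length chain_val
}.
HB.instance Definition _ n := [isSub for @chain_val n].
HB.instance Definition _ n := [Choice of chain n by <:].

Local Notation MC n := {freeg (chain n) / int}.

Definition omit n (i : nat) (x : {ffun 'I_n.+2 -> X}) : {ffun 'I_n.+1 -> X} :=
  [ffun j : 'I_n.+1 => x (fintype.lift (inord i) j)].

(* The default of insub is never used: see omit_proper. *)
Definition face n (i : nat) (x : chain n.+1) : MC n :=
  if strictly_between (x (inord i.-1)) (x (inord i)) (x (inord i.+1))
  then oapp (fun y : chain n => << y >>) 0 (insub (omit i x))
  else 0.

(* The differential from degree n.+1 to degree n. *)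
Definition diff n (c : MC n.+1) : MC n :=
  \sum_(1 <= i < n.+1) (-1) ^+ i *: fglift (@face n i) c.

Lemma omit_inord n i (x : {ffun 'I_n.+2 -> X}) j :
  (i <= n.+1)%N -> (j <= n)%N ->
  omit i x (inord j) = x (inord (bump i j)).
Proof.
move=> hi hj; rewrite ffunE; congr (x _); apply: val_inj => /=.
have hb : (bump i j < n.+2)%N by rewrite /bump; lia.
by rewrite !inordK.
Qed.

Lemma tuple_length_nat n (x : {ffun 'I_n.+1 -> X}) :
  tuple_length x = \sum_(0 <= i < n) mdist (x (inord i)) (x (inord i.+1)).
Proof. by rewrite big_mkord. Qed.

Lemma omit_length n i (x : {ffun 'I_n.+2 -> X}) : (0 < i < n.+1)%N ->
  tuple_length (omit i x) + (mdist (x (inord i.-1)) (x (inord i)) +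
    mdist (x (inord i)) (x (inord i.+1))) =
  tuple_length x + mdist (x (inord i.-1)) (x (inord i.+1)).
Proof.
case: i => // i /= hi; rewrite !tuple_length_nat.
rewrite (big_cat_nat (n := i)) //=; last by rewrite ltnW.
rewrite [X in _ + X + _](big_cat_nat (n := i.+1)) //= big_nat1.
rewrite [in RHS](big_cat_nat (n := i)) //=; last by rewrite ltnW // ltnW.
rewrite [X in _ = _ + X + _](big_cat_nat (n := i.+2)) //=; last by rewrite ltnW.
rewrite [X in _ = _ + (X + _) + _]big_nat_recr //= big_nat1.
have -> : \sum_(0 <= j < i)
            mdist (omit i.+1 x (inord j)) (omit i.+1 x (inord j.+1)) =
          \sum_(0 <= j < i) mdist (x (inord j)) (x (inord j.+1)).
  apply: eq_big_nat => j /andP[_ hj].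
  rewrite !omit_inord; try lia.
  by have [-> ->] :
    bump i.+1 j = j /\ bump i.+1 j.+1 = j.+1 by rewrite /bump; lia.
have -> : \sum_(i.+1 <= j < n)
            mdist (omit i.+1 x (inord j)) (omit i.+1 x (inord j.+1)) =
          \sum_(i.+2 <= j < n.+1) mdist (x (inord j)) (x (inord j.+1)).
  rewrite [RHS]big_add1 /=; apply: eq_big_nat => j /andP[hj1 hj2].
  rewrite !omit_inord; try lia.
  by have [-> ->] :
    bump i.+1 j = j.+1 /\ bump i.+1 j.+1 = j.+2 by rewrite /bump; lia.
have -> : mdist (omit i.+1 x (inord i)) (omit i.+1 x (inord i.+1)) =
          mdist (x (inord i)) (x (inord i.+2)).
  rewrite !omit_inord; try lia.
  by have [-> ->] :
    bump i.+1 i = i /\ bump i.+1 i.+1 = i.+2 by rewrite /bump; lia.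
ring.
Qed.

Lemma chain_proper n (x : chain n) (i : nat) : (i < n)%N ->
  x (inord i) != x (inord i.+1).
Proof. by case: x => x /= /andP[/forallP hx _] hi; have := hx (Ordinal hi). Qed.

Lemma chain_length n (x : chain n) : tuple_length x = l.
Proof. by case: x => x /= /andP[_ /eqP]. Qed.

Lemma omit_length_le n i (x : {ffun 'I_n.+2 -> X}) : (0 < i < n.+1)%N ->
  tuple_length (omit i x) <= tuple_length x.
Proof.
move=> hi; have := omit_length x hi.
have := metric_triangle (x (inord i.-1)) (x (inord i)) (x (inord i.+1)).
lra.
Qed.

Lemma omit_proper n i (x : chain n.+1) : (0 < i < n.+1)%N ->
  strictly_between (x (inord i.-1)) (x (inord i)) (x (inord i.+1)) =
  proper_of_length (omit i x).
Proof.
move=> hi; have hl := omit_length x hi; rewrite chain_length in hl.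
apply/idP/idP => [/and3P[/eqP hd hne _]|/andP[_ /eqP hx]].
  apply/andP; split; last by apply/eqP; lra.
  have hpos : x (inord i.-1) != x (inord i.+1).
    rewrite -mdist_gt0 hd ltr_pwDl ?mdist_ge0 //.
    by rewrite mdist_gt0 eq_sym.
  apply/forallP => j; have hj := ltn_ord j.
  rewrite !omit_inord; try lia.
  have [hji|hji|hji] := ltngtP j i.-1.
  - have [-> ->] : bump i j = j /\ bump i j.+1 = j.+1 by rewrite /bump; lia.
    by apply: chain_proper; lia.
  - have [-> ->] : bump i j = j.+1 /\ bump i j.+1 = j.+2 by rewrite /bump; lia.
    by apply: chain_proper; lia.
  - by have [-> ->] :
      bump i j = i.-1 /\ bump i j.+1 = i.+1 by rewrite /bump; lia.
apply/and3P; split; first by apply/eqP; lra.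
- by rewrite eq_sym -{2}(@prednK i) ?chain_proper //; lia.
- by apply: chain_proper; lia.
Qed.

Definition of_tuple n (x : {ffun 'I_n.+1 -> X}) : MC n :=
  oapp (fun y : chain n => << y >>) 0 (insub x).

Lemma faceE n i (x : chain n.+1) : (0 < i < n.+1)%N ->
  face i x = of_tuple (omit i x).
Proof.
move=> hi; rewrite /face omit_proper // /of_tuple.
by case: ifP => // hx; rewrite insubF.
Qed.

Lemma diff_is_zmod_morphism n : zmod_morphism (@diff n).
Proof.
move=> c c'; rewrite /diff -sumrB; apply: eq_bigr => i _.
by rewrite -scalerBr; congr (_ *: _); apply: lift_is_additive.
Qed.

HB.instance Definition _ n :=
  GRing.isZmodMorphism.Build (MC n.+1) (MC n) (@diff n)
    (@diff_is_zmod_morphism n).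

Lemma diff_basis n (x : chain n.+1) :
  diff << x >> = \sum_(1 <= i < n.+1) (-1) ^+ i *: of_tuple (omit i x).
Proof.
rewrite /diff; apply: eq_big_nat => i hi.
by rewrite liftU scale1r faceE.
Qed.

Lemma diff_of_tuple_omit n (i : nat) (x : chain n.+2) : (0 < i < n.+2)%N ->
  diff (of_tuple (omit i x)) =
  \sum_(1 <= j < n.+1) (-1) ^+ j *: of_tuple (omit j (omit i x)).
Proof.
move=> hi; rewrite {1}/of_tuple; case: insubP => [y _ hy|hx] /=.
  by rewrite diff_basis hy.
rewrite raddf0 big_nat big1 // => j hj.
rewrite /of_tuple insubF ?scaler0 //; apply/negbTE.
apply: contra hx => /andP[_ /eqP hl]; rewrite -omit_proper // omit_proper //.
suff hle : tuple_length (omit i x) = l.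
  have := omit_length x hi; rewrite hle chain_length => /addrI hd.
  rewrite -omit_proper //; apply/and3P; split; first by apply/eqP.
  - by rewrite eq_sym -{2}(@prednK i) ?chain_proper //; lia.
  - by apply: chain_proper; lia.
apply/eqP; rewrite eq_le; apply/andP; split.
  by have := omit_length_le x hi; rewrite chain_length.
by have := omit_length_le (omit i x) hj; rewrite hl.
Qed.

Lemma omit_omit n (i j : nat) (x : {ffun 'I_n.+3 -> X}) :
  (j <= i)%N -> (i <= n.+1)%N -> omit i (omit j x) = omit j (omit i.+1 x).
Proof.
move=> hji hi; apply/ffunP => k; have hk := ltn_ord k.
rewrite -[k]inord_val !omit_inord; try (rewrite ?/bump; lia).
by congr (x (inord _)); rewrite /bump; lia.
Qed.

Lemma diff_diff n (c : MC n.+2) : diff (diff c) = 0.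
Proof.
suff hb (x : chain n.+2) : diff (diff << x >>) = 0.
  rewrite -[c]freeg_sumE (raddf_sum (@diff n.+1)) (raddf_sum (@diff n)).
  rewrite big1 // => x _.
  rewrite -[coeff x c]intz -freegU_mulz.
  rewrite (raddfMz (@diff n.+1)) (raddfMz (@diff n)).
  by rewrite [X in X *~ _](hb x) mul0rz.
rewrite diff_basis raddf_sum /=.
pose G i j : MC n := (-1) ^+ (i + j) *: of_tuple (omit j (omit i x)).
transitivity (\sum_(1 <= i < n.+2) \sum_(1 <= j < n.+1) G i j).
  apply: eq_big_nat => i hi.
  have -> : (-1) ^+ i *: of_tuple (omit i x) =
            of_tuple (omit i x) *~ (-1) ^+ i :> MC n.+1.
    by rewrite -scaler_int intz.
  rewrite raddfMz [X in X *~ _](diff_of_tuple_omit x hi).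
  rewrite -scaler_int intz scaler_sumr.
  by apply: eq_bigr => j _; rewrite scalerA -exprD.
transitivity (\sum_(1 <= i < n.+2) (\sum_(1 <= j < n.+1 | (j < i)%N) G i j +
                                    \sum_(1 <= j < n.+1 | (i <= j)%N) G i j)).
  apply: eq_bigr => i _; rewrite (bigID (fun j => (j < i)%N)) /=; congr (_ + _).
  by apply: eq_bigl => j; rewrite -leqNgt.
rewrite big_split /=.
have -> : \sum_(1 <= i < n.+2) \sum_(1 <= j < n.+1 | (j < i)%N) G i j =
          \sum_(1 <= i < n.+1) \sum_(1 <= j < n.+1 | (j <= i)%N) G i.+1 j.
  rewrite big_nat_recl // [X in X + _]big_nat_cond [X in X + _]big1 ?add0r //.
  by move=> j; lia.
have -> : \sum_(1 <= i < n.+2) \sum_(1 <= j < n.+1 | (i <= j)%N) G i j =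
          \sum_(1 <= i < n.+1) \sum_(1 <= j < n.+1 | (j <= i)%N) G j i.
  rewrite big_nat_recr //= [X in _ + X]big_nat_cond [X in _ + X]big1 ?addr0.
    by rewrite (exchange_big_dep_nat (fun j => true)).
  by move=> j; lia.
rewrite -big_split /=.
rewrite big_nat big1 // => i hi.
rewrite -big_split /=.
rewrite big_nat_cond big1 // => j /andP[hj hji].
rewrite /G (@omit_omit _ i j); try lia.
by rewrite addSn exprS mulN1r scaleNr [(j + i)%N]addnC addNr.
Qed.

Definition is_cycle n : {pred MC n} :=
  match n return {pred MC n} with
  | 0 => predT
  | m.+1 => fun c => diff c == 0
  end.

Lemma is_cycle_zmod_closed n : zmod_closed (@is_cycle n).
Proof.
case: n => [|n]; split => //; first by apply/eqP; apply: (raddf0 (@diff n)).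
move=> c c' /eqP hc /eqP hc'; apply/eqP.
by rewrite /= diff_is_zmod_morphism hc hc' subrr.
Qed.

HB.instance Definition _ n :=
  GRing.isZmodClosed.Build (MC n) (@is_cycle n) (@is_cycle_zmod_closed n).

Record cycle n := Cycle { cycle_val :> MC n; _ : cycle_val \in @is_cycle n }.
HB.instance Definition _ n := [isSub for @cycle_val n].
HB.instance Definition _ n := [Choice of cycle n by <:].
HB.instance Definition _ n := [SubChoice_isSubZmodule of cycle n by <:].

Definition is_boundary n : {pred cycle n} :=
  fun z => `[< exists b : MC n.+1, diff b = z >].

Lemma is_boundary_zmod_closed n : zmod_closed (@is_boundary n).
Proof.
split=> [|z z' /asboolP[b hb] /asboolP[b' hb']]; apply/asboolP.
  by exists 0; rewrite raddf0.
by exists (b - b'); rewrite diff_is_zmod_morphism hb hb'.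
Qed.

HB.instance Definition _ n :=
  GRing.isZmodClosed.Build (cycle n) (@is_boundary n)
    (@is_boundary_zmod_closed n).

(* Cycles modulo boundaries; the decidability of being a boundary, required by
   the quotient construction, is classical. *)
Definition MH n : zmodType := Quotient.quot (@is_boundary n).

Lemma MH_eq0 n : (forall x : MH n.+1, x = 0) <->
  (forall c : MC n.+1, diff c = 0 -> exists b : MC n.+2, diff b = c).
Proof.
split=> [h c hc|h x].
  have hz : c \in @is_cycle n.+1 by apply/eqP.
  have := h (\pi_(Quotient.quot (@is_boundary n.+1)) (Cycle hz))%qT.
  rewrite -[RHS](raddf0 (\pi_(Quotient.quot (@is_boundary n.+1)))%qT).
  by move/eqP; rewrite -Quotient.idealrBE subr0 => /asboolP.
rewrite -[x]reprK -[RHS](raddf0 (\pi_(Quotient.quot (@is_boundary n.+1)))%qT).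
apply/eqP; rewrite -Quotient.idealrBE subr0.
by apply/asboolP; apply: h; case: (repr x) => c /= /eqP.
Qed.

End MagnitudeHomology.

(* Main.v *)
Require Import Defs.
From HB Require Import structures.
From mathcomp Require Import all_boot all_order all_algebra.
From mathcomp Require Import all_classical all_reals all_analysis.
From mathcomp Require Import freeg.
From mathcomp Require Import zify ring lra.

Set Implicit Arguments.
Unset Strict Implicit.
Unset Printing Implicit Defensive.

Import Order.TTheory GRing.Theory Num.Theory.

Local Open Scope ring_scope.

(** The chain complex contracts by pushing each chain along its first edge.

    A cycle [c] of positive degree involves finitely many chains, so some
    [eps > 0] is smaller than all their first steps [d(x_0, x_1)].  Insert into
    [(x_0, ..., x_n)], right after [x_0], the point [pt x_0 x_1] at distance
    [eps] from [x_0] on a geodesic from [x_0] to [x_1].  Deleting the inserted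
    point gives the chain back, and deleting a later point commutes with the
    insertion, with the opposite sign since positions are shifted by one.  So
    the insertion is a homotopy between [0] and [-id] on such chains
    ([insertion_homotopy]), and [c] bounds ([insertion_cycle]).  Only the
    deletion of [x_1] needs geometry:
    - if [x_1] lies between [x_0] and [x_2], the inserted point must not change
      when [x_1] is deleted, i.e. [pt x_0 x_1 = pt x_0 x_2]: the point at
      distance [eps] from [x_0] towards [x_2] is unique
      ([geodesic_point_unique]);
    - [x_1] must be deletable after the insertion only if it was before: if
      [x_1] lies between [pt x_0 x_1] and [x_2], then it lies between [x_0] and
      [x_2].  This is the local-to-global property of geodesics shorter than
      the diameter of the model surface ([no_4_cut]).

    Both facts are extreme cases of one comparison ([CAT_cevian]): in a geodesic
    triangle [c a d], a point [b] of the side [c a] is no further from [d] than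
    in the model surface.  If the comparison triangle has angle 0 at [c] and
    [b] is as far from [c] as [d], the model distance is 0, so [b = d].  If its
    angle at [c] is less than [pi] and [b] is not [c], the model distance is
    less than [d(c, b) + d(c, d)]; hence if [c] lies between [b] and [d], then
    the angle is [pi] and [c] lies between [a] and [d].

    In the model surface, geodesics are explicit combinations of their
    endpoints, and Stewart's theorem gives the distance from their points to
    any third point ([curved_geodesic], [flat_geodesic]).  Nonzero curvatures
    of both signs are treated at once, by a trigonometry whose addition
    formulas carry the sign of the curvature. *)

(** * Comparison triangles *)

(** A triangle with side lengths [P], [E], [Q], together with the two extreme
    cases of the law of cosines at [c] that the argument uses: the angle 0, and
    all angles less than [pi]. *)
Definition sharp_comparison_triangle {R : realType} (kappa P Q E : R) : Prop :=
  exists (c a d : model kappa) (S0 S1 S2 : set (model kappa)),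
    [/\ geodesic_segment (@model_dist R kappa) c a S0,
        geodesic_segment (@model_dist R kappa) a d S1 &
        geodesic_segment (@model_dist R kappa) d c S2] /\
    [/\ model_dist c a = P, model_dist a d = E, model_dist d c = Q &
    forall beta, 0 <= beta <= P -> exists b, [/\ S0 b, model_dist c b = beta,
      E = P - Q -> beta = Q -> model_dist b d = 0 &
      0 < beta -> E < P + Q -> model_dist b d < beta + Q]].

(** * The model surface of nonzero curvature *)

Section CurvedModel.
Context {R : realType}.
Variable kappa : R.
Hypothesis kappa_neq0 : kappa != 0.

Definition curv_scale : R := Num.sqrt `|kappa|.

(** [cs] and [sn] are the cosine and sine of the rescaled length, circular or
    hyperbolic according to the sign of the curvature. *)
Definition cs (t : R) : R :=
  if 0 < kappa then cos (curv_scale * t)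
  else (expR (curv_scale * t) + expR (- (curv_scale * t))) / 2.

Definition sn (t : R) : R :=
  if 0 < kappa then sin (curv_scale * t)
  else (expR (curv_scale * t) - expR (- (curv_scale * t))) / 2.

(** The Euclidean or, up to sign, Lorentzian inner product: the model surface is
    a level set of its quadratic form, and its value at two points is [cs] of
    their distance. *)
Definition model_form (p q : R * R * R) : R :=
  p.2 * q.2 + Num.sg kappa * (p.1.1 * q.1.1 + p.1.2 * q.1.2).

Definition dist_of_form (c : R) : R :=
  (if 0 < kappa then acos c else arcosh c) / curv_scale.

Local Notation sigma := (Num.sg kappa).
Local Notation k := curv_scale.

Lemma kappa_cases :
  (0 < kappa /\ sigma = 1) \/ ((0 < kappa) = false /\ kappa < 0 /\ sigma = -1).
Proof.
case: (ltrgt0P kappa) kappa_neq0 => // h _; [left|right].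
  by rewrite gtr0_sg.
by rewrite ltr0_sg.
Qed.

Lemma curv_scale_gt0 : 0 < k.
Proof. by rewrite sqrtr_gt0 normr_gt0. Qed.

Lemma model_distE (p q : model kappa) :
  model_dist p q = dist_of_form (model_form (val p) (val q)).
Proof.
case: p q => [[[x1 y1] z1] hp] [[[x2 y2] z2] hq].
rewrite /model_dist /dist_of_form /model_form /curv_scale /=.
case: kappa_cases => [[hk ->]|[-> [hk ->]]].
  by rewrite hk (gtr0_norm hk); congr (acos _ / _); ring.
by rewrite hk (ltr0_norm hk); congr (arcosh _ / _); ring.
Qed.

Lemma on_modelE (p : R * R * R) :
  on_model kappa p = (model_form p p == 1) && ((0 < kappa) || (0 < p.2)).
Proof.
case: p => [[x y] z]; rewrite /on_model /model_form /=.
case: kappa_cases => [[hk ->]|[hk1 [hk ->]]].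
  by rewrite hk andbT; congr (_ == _); ring.
by rewrite hk1 hk; congr ((_ == _) && _); ring.
Qed.

Lemma sn0 : sn 0 = 0.
Proof.
by rewrite /sn; case: ifP => _; rewrite !mulr0 ?sin0 // oppr0 subrr mul0r.
Qed.

Lemma csB s t : cs (s - t) = cs s * cs t + sigma * sn s * sn t.
Proof.
rewrite /cs /sn mulrBr; case: kappa_cases => [[-> ->]|[-> [_ ->]]].
  by rewrite cosB; ring.
rewrite opprB !expRB !expRN.
have := expR_gt0 (k * s); have := expR_gt0 (k * t) => ht hs.
by field; rewrite !gt_eqF.
Qed.

Lemma snB s t : sn (s - t) = sn s * cs t - cs s * sn t.
Proof.
rewrite /cs /sn mulrBr; case: kappa_cases => [[-> _]|[-> [_ _]]].
  by rewrite sinB; ring.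
rewrite opprB !expRB !expRN.
have := expR_gt0 (k * s); have := expR_gt0 (k * t) => ht hs.
by field; rewrite !gt_eqF.
Qed.

Lemma cs0 : cs 0 = 1.
Proof.
rewrite /cs !mulr0; case: ifP => _; first exact: cos0.
by rewrite oppr0 expR0; field.
Qed.

Lemma snN t : sn (- t) = - sn t.
Proof. by rewrite -sub0r snB sn0 cs0; ring. Qed.

Lemma csN t : cs (- t) = cs t.
Proof. by rewrite -sub0r csB sn0 cs0; ring. Qed.

Lemma csD s t : cs (s + t) = cs s * cs t - sigma * sn s * sn t.
Proof. by rewrite -[t]opprK csB !csN !snN opprK; ring. Qed.

Lemma cs2Dsn2 t : cs t ^+ 2 + sigma * sn t ^+ 2 = 1.
Proof. by have := csB t t; rewrite subrr cs0 => ->; ring. Qed.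

Lemma sigma2 : sigma * sigma = 1.
Proof. by case: kappa_cases => [[_ ->]|[_ [_ ->]]]; ring. Qed.

Lemma curv_scale_lt_pi t : 0 < kappa -> (t%:E < model_diam kappa)%E ->
  k * t < pi.
Proof.
move=> hk; rewrite /model_diam hk lte_fin ltr_pdivlMr ?sqrtr_gt0 //.
by rewrite /curv_scale (gtr0_norm hk) mulrC.
Qed.

Lemma sn_gt0 (t : R) : 0 < t -> (t%:E < model_diam kappa)%E -> 0 < sn t.
Proof.
move=> t0 td; have kt0 : 0 < k * t by rewrite mulr_gt0 // curv_scale_gt0.
rewrite /sn; case: ifP => hk.
  by apply: sin_gt0_pi; rewrite kt0 curv_scale_lt_pi.
by rewrite divr_gt0 // subr_gt0 ltr_expR; lra.
Qed.

Lemma le_diam (s t : R) : s <= t -> (t%:E < model_diam kappa)%E ->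
  (s%:E < model_diam kappa)%E.
Proof. by move=> st; apply: le_lt_trans; rewrite lee_fin. Qed.

Lemma sn_ge0 (t : R) : 0 <= t -> (t%:E < model_diam kappa)%E -> 0 <= sn t.
Proof.
rewrite le_eqVlt => /predU1P[<- _|t0 td]; first by rewrite sn0.
exact/ltW/sn_gt0.
Qed.

(** Multiplying by the sign makes [cs] decreasing in both geometries; the
    difference is a product of two values of [sn]. *)
Lemma cs_anti (s t : R) : 0 <= s -> s < t -> (t%:E < model_diam kappa)%E ->
  sigma * cs t < sigma * cs s.
Proof.
move=> s0 st td.
set u := (t + s) / 2; set v := (t - s) / 2.
have -> : t = u + v by rewrite /u /v; field.
have -> : s = u - v by rewrite /u /v; field.
have hu : 0 < sn u.
  by apply: sn_gt0; [rewrite /u; lra|apply: le_diam td; rewrite /u; lra].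
have hv : 0 < sn v.
  by apply: sn_gt0; [rewrite /v; lra|apply: le_diam td; rewrite /v; lra].
have := mulr_gt0 hu hv.
rewrite csB csD !mulrDr mulrN !mulrA sigma2 !mul1r; lra.
Qed.

Lemma cs_anti_le (s t : R) : 0 <= s -> s <= t -> (t%:E < model_diam kappa)%E ->
  sigma * cs t <= sigma * cs s.
Proof.
move=> s0; rewrite le_eqVlt => /predU1P[-> //|st td]; exact/ltW/cs_anti.
Qed.

Lemma dist_of_form_cs (t : R) : 0 <= t -> (t%:E < model_diam kappa)%E ->
  dist_of_form (cs t) = t.
Proof.
move=> t0 td; have k0 := curv_scale_gt0.
have kt0 : 0 <= k * t by rewrite mulr_ge0 // ltW.
suff e : (if 0 < kappa then acos (cs t) else arcosh (cs t)) = k * t.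
  by rewrite /dist_of_form e mulrC mulKf // gt_eqF.
have c2 := cs2Dsn2 t; have s0 := sn_ge0 t0 td.
case: kappa_cases c2 => [[hk ->] _|[hk [_ ->]] c2].
  rewrite hk /cs hk cosK // in_itv /= kt0 /=.
  exact/ltW/curv_scale_lt_pi.
rewrite hk /arcosh.
have -> : cs t ^+ 2 - 1 = sn t ^+ 2 by lra.
rewrite sqrtr_sqr (ger0_norm s0) /cs /sn hk.
by rewrite -[RHS]expRK; congr (ln _); field.
Qed.

(** The upper bound on [c] says that [c] is the cosine, circular or hyperbolic,
    of an actual length; it is needed because [acos] and [arcosh] are monotone
    only on those values. *)
Lemma dist_of_form_lt (T c : R) : 0 < T -> (T%:E < model_diam kappa)%E ->
  sigma * cs T < sigma * c -> sigma * c <= sigma -> dist_of_form c < T.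
Proof.
move=> T0 Td; have k0 := curv_scale_gt0.
have e := dist_of_form_cs (ltW T0) Td => h1 h2.
rewrite -{}[X in _ < X]e /dist_of_form ltr_pM2r ?invr_gt0 //.
case: kappa_cases h1 h2 => [[hk ->]|[hk [_ ->]]].
  rewrite hk !mul1r => h1 h2.
  have cT : -1 <= cs T by rewrite /cs hk; exact: cos_geN1.
  have cI : -1 <= c <= 1 by lra.
  have TI : -1 <= cs T <= 1 by lra.
  rewrite ltNge; apply/negP => h.
  have : cos (acos c) <= cos (acos (cs T)).
    by rewrite leNgt ltr_cos -?leNgt ?in_itv /= ?acos_ge0 ?acos_lepi.
  by rewrite !acosK ?in_itv //= leNgt h1.
rewrite hk !mulN1r => h1 h2; have {h2}c1 : 1 <= c by lra.
have {h1}cT : c < cs T by lra.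
rewrite /arcosh ltr_ln ?posrE; last 2 first.
- by have := sqrtr_ge0 (c ^+ 2 - 1); lra.
- by have := sqrtr_ge0 (cs T ^+ 2 - 1); lra.
by apply: ltr_leD => //; rewrite ler_sqrt; nra.
Qed.

(** Nonnegative combinations stay on the upper sheet of the hyperboloid, so the
    quadratic equation alone decides membership. *)
Lemma form_combination (A B : R) (p q : R * R * R) :
  on_model kappa p -> on_model kappa q -> 0 <= A -> 0 <= B -> 0 < A + B ->
  let r := (A * p.1.1 + B * q.1.1, A * p.1.2 + B * q.1.2, A * p.2 + B * q.2) in
  model_form r r = 1 -> on_model kappa r.
Proof.
move=> hp hq A0 B0 AB r hr; rewrite on_modelE hr eqxx /=.
move: hp hq; rewrite !on_modelE => /andP[_ /orP[->//|hp]] /andP[_ hq].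
case/orP: hq => [->//|hq]; apply/orP; right; rewrite /r /=.
move: A0; rewrite le_eqVlt => /predU1P[A0|A0]; last first.
  by rewrite ltr_pwDl ?mulr_gt0 ?mulr_ge0 // ltW.
by rewrite -A0 mul0r add0r mulr_gt0 //; lra.
Qed.

(** The geodesic is the spherical or hyperbolic linear interpolation of [p] and
    [q]; being linear in them, it makes [model_form] against any third point
    computable along the geodesic (Stewart's theorem). *)
Lemma curved_geodesic (p q : model kappa) (L : R) : 0 < L ->
  (L%:E < model_diam kappa)%E -> model_form (val p) (val q) = cs L ->
  exists gamma : R -> model kappa,
    [/\ gamma 0 = p, gamma L = q, geodesic (@model_dist R kappa) L gamma &
    forall t (r : model kappa), 0 <= t <= L ->
      sn L * model_form (val (gamma t)) (val r) =
      sn (L - t) * model_form (val p) (val r) +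
      sn t * model_form (val q) (val r)].
Proof.
move=> L0 Ld hpq; have sL := sn_gt0 L0 Ld.
have hpp : model_form (val p) (val p) = 1.
  by have := valP p; rewrite on_modelE => /andP[/eqP].
have hqq : model_form (val q) (val q) = 1.
  by have := valP q; rewrite on_modelE => /andP[/eqP].
pose A t := sn (L - t) / sn L; pose B t := sn t / sn L.
pose r t := (A t * (val p).1.1 + B t * (val q).1.1,
             A t * (val p).1.2 + B t * (val q).1.2,
             A t * (val p).2 + B t * (val q).2).
have hr s t : model_form (r s) (r t) = cs (s - t).
  have -> : model_form (r s) (r t) =
      A s * A t * model_form (val p) (val p) +
      B s * B t * model_form (val q) (val q) +
      (A s * B t + B s * A t) * model_form (val p) (val q).
    by rewrite /model_form /r /=; ring.
  rewrite hpp hqq hpq /A /B !snB csB.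
  have e : sigma = (1 - cs L ^+ 2) / sn L ^+ 2.
    by have := cs2Dsn2 L => <-; field; rewrite gt_eqF.
  by rewrite e; field; rewrite gt_eqF.
have on_r t : 0 <= t <= L -> on_model kappa (r t).
  move=> /andP[t0 tL].
  have hA : 0 <= sn (L - t) by apply: sn_ge0; [lra|apply: le_diam Ld; lra].
  have hB : 0 <= sn t by apply: sn_ge0 => //; apply: le_diam Ld; lra.
  apply: (form_combination (valP p) (valP q)); rewrite -/(r t).
  - by rewrite divr_ge0 // ltW.
  - by rewrite divr_ge0 // ltW.
  - rewrite -mulrDl divr_gt0 //.
    move: t0; rewrite le_eqVlt => /predU1P[<-|t0].
      by rewrite subr0 sn0 addr0.
    by rewrite ltr_wpDl // sn_gt0 //; apply: le_diam Ld; lra.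
  - by rewrite hr subrr cs0.
(* Off [0, L] the interpolation may leave the hyperbolic sheet; any value does
   there, whence the default [p]. *)
pose gamma t : model kappa := insubd (p : {x | on_model kappa x}) (r t).
have gE t : 0 <= t <= L -> val (gamma t) = r t.
  by move=> ht; rewrite val_insubd on_r.
exists gamma; split.
- apply: val_inj; rewrite gE ?lexx ?ltW //= /r /A /B subr0 sn0 divff ?gt_eqF //.
  by rewrite !mul0r !mul1r !addr0 -!surjective_pairing.
- apply: val_inj; rewrite gE ?lexx ?ltW //= /r /A /B subrr sn0 divff ?gt_eqF //.
  by rewrite !mul0r !mul1r !add0r -!surjective_pairing.
- split; first exact: ltW.
  move=> s t hs ht; rewrite model_distE !gE // hr.
  have -> : cs (s - t) = cs `|s - t|.
    by case: (ger0P (s - t)) => // _; rewrite csN.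
  rewrite dist_of_form_cs ?normr_ge0 //; apply: le_diam Ld.
  by rewrite ler_norml; lra.
- move=> t r0 ht; rewrite gE // /model_form /r /A /B /=; field.
  by rewrite gt_eqF.
Qed.

(** The vertex [c] is the pole, and [u] is the cosine of the angle at [c] that
    the law of cosines prescribes. *)
Lemma curved_vertices (P Q E : R) : 0 < P -> 0 < Q ->
  `|P - Q| <= E -> E <= P + Q -> ((P + Q)%:E < model_diam kappa)%E ->
  exists c a d : model kappa,
    [/\ model_form (val c) (val a) = cs P, model_form (val a) (val d) = cs E &
        model_form (val d) (val c) = cs Q].
Proof.
move=> P0 Q0 PQE EPQ hdiam.
have sP : 0 < sn P by apply: sn_gt0 => //; apply: le_diam hdiam; lra.
have sQ : 0 < sn Q by apply: sn_gt0 => //; apply: le_diam hdiam; lra.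
have E0 : 0 <= E by apply: le_trans PQE.
have h1 : sigma * cs (P + Q) <= sigma * cs E by apply: cs_anti_le.
have h2 : sigma * cs E <= sigma * cs (P - Q).
  have -> : cs (P - Q) = cs `|P - Q|.
    by case: (ger0P (P - Q)) => // _; rewrite csN.
  by apply: cs_anti_le => //; apply: le_diam hdiam.
pose u := sigma * (cs E - cs P * cs Q) / (sn P * sn Q).
have s2 := sigma2.
have sPQ : 0 < sn P * sn Q by rewrite mulr_gt0.
have /andP[u1 u2] : -1 <= u <= 1.
  rewrite /u ler_pdivrMr // ler_pdivlMr //.
  move: h1 h2; rewrite csB csD !mulrDr mulrN !mulrA s2; lra.
have u3 : 0 <= 1 - u ^+ 2 by nra.
pose v := Num.sqrt (1 - u ^+ 2).
have v2 : v ^+ 2 = 1 - u ^+ 2 by rewrite sqr_sqrtr.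
have pos t : (0 < kappa) || (0 < cs t).
  case: (boolP (0 < kappa)) => //= /negbTE hk; rewrite /cs hk.
  by rewrite divr_gt0 // addr_gt0 // expR_gt0.
have cP := cs2Dsn2 P; have cQ := cs2Dsn2 Q.
have hc : on_model kappa (0, 0, 1).
  by rewrite on_modelE /model_form /= ltr01 orbT andbT; apply/eqP; ring.
have ha : on_model kappa (sn P, 0, cs P).
  by rewrite on_modelE pos andbT -cP; apply/eqP; rewrite /model_form /=; ring.
have hd : on_model kappa (sn Q * u, sn Q * v, cs Q).
  rewrite on_modelE pos andbT -cQ; apply/eqP; rewrite /model_form /=.
  transitivity (cs Q ^+ 2 + sigma * (sn Q ^+ 2 * (u ^+ 2 + v ^+ 2))).
    by ring.
  by rewrite v2; ring.
pose pt x hx : model kappa := exist (on_model kappa) x hx.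
exists (pt _ hc), (pt _ ha), (pt _ hd); rewrite /model_form /=.
split; try ring.
transitivity (cs P * cs Q + sigma * sigma * (cs E - cs P * cs Q)).
  by rewrite /u; field; rewrite !gt_eqF.
by rewrite s2; ring.
Qed.

Lemma curved_comparison (P Q E : R) : 0 < P -> 0 < Q -> 0 < E ->
  `|P - Q| <= E -> E <= P + Q -> ((P + Q)%:E < model_diam kappa)%E ->
  sharp_comparison_triangle kappa P Q E.
Proof.
move=> P0 Q0 E0 PQE EPQ hdiam.
have [c [a [d [hca had hdc]]]] := curved_vertices P0 Q0 PQE EPQ hdiam.
have Pd : (P%:E < model_diam kappa)%E by apply: le_diam hdiam; lra.
have Qd : (Q%:E < model_diam kappa)%E by apply: le_diam hdiam; lra.
have Ed : (E%:E < model_diam kappa)%E by apply: le_diam hdiam; lra.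
have [g0 [g00 g0P gg0 stew]] := curved_geodesic P0 Pd hca.
have [g1 [g10 g1E gg1 _]] := curved_geodesic E0 Ed had.
have [g2 [g20 g2Q gg2 _]] := curved_geodesic Q0 Qd hdc.
exists c, a, d, [set g0 t | t in [set t | 0 <= t <= P]]%classic,
  [set g1 t | t in [set t | 0 <= t <= E]]%classic,
  [set g2 t | t in [set t | 0 <= t <= Q]]%classic.
split; first by split; [exists P, g0|exists E, g1|exists Q, g2].
split.
- by rewrite model_distE hca dist_of_form_cs // ltW.
- by rewrite model_distE had dist_of_form_cs // ltW.
- by rewrite model_distE hdc dist_of_form_cs // ltW.
move=> beta hbeta; exists (g0 beta).
have sP := sn_gt0 P0 Pd.
have hb := stew _ d hbeta.
rewrite had in hb.
have hcd : model_form (val c) (val d) = cs Q by rewrite -hdc /model_form; ring.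
rewrite hcd in hb.
(* The length of the cevian when the angle at c is pi, resp. 0. *)
have stewD : sn (P - beta) * cs Q + sn beta * cs (P + Q) = sn P * cs (beta + Q).
  by rewrite snB !csD; ring.
have stewB : sn (P - beta) * cs Q + sn beta * cs (P - Q) = sn P * cs (beta - Q).
  by rewrite snB !csB; ring.
move/andP: hbeta => [beta0 betaP].
split.
- by exists beta; rewrite //= beta0.
- have -> : model_dist c (g0 beta) = `|0 - beta|.
    by rewrite -g00; apply: gg0.2; rewrite ?lexx ?beta0 //= ltW.
  by rewrite sub0r normrN ger0_norm.
- move=> hE hQ; rewrite model_distE.
  have -> : model_form (val (g0 beta)) (val d) = cs 0.
    apply: (mulfI (lt0r_neq0 sP)).
    by rewrite hb hE hQ subrr in stewB *.
  by rewrite dist_of_form_cs //; apply: le_diam hdiam; lra.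
- move=> beta1 hE; rewrite model_distE.
  have sb : 0 < sn beta by apply: sn_gt0 => //; apply: le_diam hdiam; lra.
  apply: dist_of_form_lt => //.
  + lra.
  + by apply: le_diam hdiam; lra.
  + rewrite -(ltr_pM2l sP) mulrCA -stewD [ltRHS]mulrCA hb !mulrDr ltrD2l.
    rewrite !(mulrCA sigma) ltr_pM2l //; apply: cs_anti => //; exact: ltW.
  rewrite -(ler_pM2l sP) mulrCA hb.
  apply: (@le_trans _ _ (sn P * (sigma * cs (beta - Q)))).
    rewrite [leRHS]mulrCA -stewB !mulrDr lerD2l !(mulrCA sigma) ler_pM2l //.
    have -> : cs (P - Q) = cs `|P - Q|.
      by case: (ger0P (P - Q)) => // _; rewrite csN.
    by apply: cs_anti_le.
  rewrite ler_pM2l //.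
  have -> : cs (beta - Q) = cs `|beta - Q|.
    by case: (ger0P (beta - Q)) => // _; rewrite csN.
  rewrite -{2}[sigma]mulr1 -(cs0); apply: cs_anti_le => //.
  by apply: le_diam hdiam; rewrite ler_norml; lra.
Qed.

End CurvedModel.

(** * The flat model surface *)

Section FlatModel.
Context {R : realType}.
Variable kappa : R.
Hypothesis kappa_eq0 : kappa = 0.

Definition sqdist (p q : R * R * R) : R :=
  (p.1.1 - q.1.1) ^+ 2 + (p.1.2 - q.1.2) ^+ 2.

Lemma flat_distE (p q : model kappa) :
  model_dist p q = Num.sqrt (sqdist (val p) (val q)).
Proof.
case: p q => [[[x1 y1] z1] hp] [[[x2 y2] z2] hq].
by rewrite /model_dist /sqdist /= kappa_eq0 ltxx.
Qed.

Lemma flat_on_model x y : on_model kappa (x, y, 0).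
Proof. by rewrite /on_model kappa_eq0 ltxx /=. Qed.

Definition flat_point x y : model kappa :=
  exist (on_model kappa) (x, y, 0) (flat_on_model x y).

Lemma flat_pointE (p : model kappa) : p = flat_point (val p).1.1 (val p).1.2.
Proof.
case: p => [[[x y] z] hp]; apply: val_inj => /=; congr (_, _, _).
by move: hp; rewrite /on_model kappa_eq0 ltxx => /eqP.
Qed.

(** The last clause is Stewart's theorem for a point dividing [p q] in the ratio
    [t : L - t]. *)
Lemma flat_geodesic (p q : model kappa) (L : R) : 0 < L ->
  sqdist (val p) (val q) = L ^+ 2 ->
  exists gamma : R -> model kappa,
    [/\ gamma 0 = p, gamma L = q, geodesic (@model_dist R kappa) L gamma &
    forall t (r : model kappa),
      L * sqdist (val (gamma t)) (val r) =
      (L - t) * sqdist (val p) (val r) + t * sqdist (val q) (val r)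
      - t * (L - t) * L].
Proof.
move=> L0 hpq.
exists (fun t => flat_point
  (((L - t) * (val p).1.1 + t * (val q).1.1) / L)
  (((L - t) * (val p).1.2 + t * (val q).1.2) / L)).
split.
- by rewrite [RHS]flat_pointE; congr flat_point; field; rewrite gt_eqF.
- by rewrite [RHS]flat_pointE; congr flat_point; field; rewrite gt_eqF.
- split; first exact: ltW.
  move=> s t _ _; rewrite flat_distE -sqrtr_sqr; congr Num.sqrt.
  transitivity ((s - t) ^+ 2 / L ^+ 2 * sqdist (val p) (val q)).
    by rewrite /sqdist /=; field; rewrite gt_eqF.
  by rewrite hpq; field; rewrite gt_eqF.
- move=> t r.
  have -> : t * (L - t) * L = t * (L - t) / L * sqdist (val p) (val q).
    by rewrite hpq; field; rewrite gt_eqF.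
  by rewrite /sqdist /=; field; rewrite gt_eqF.
Qed.

Lemma flat_vertices (P Q E : R) : 0 < P -> 0 < Q -> `|P - Q| <= E ->
  E <= P + Q ->
  exists c a d : model kappa,
    [/\ sqdist (val c) (val a) = P ^+ 2, sqdist (val a) (val d) = E ^+ 2 &
        sqdist (val d) (val c) = Q ^+ 2].
Proof.
move=> P0 Q0; rewrite ler_norml => /andP[h1 h2] h3.
pose u := (P ^+ 2 + Q ^+ 2 - E ^+ 2) / (2 * P * Q).
have PQ : 0 < 2 * P * Q by rewrite !mulr_gt0.
have /andP[u1 u2] : -1 <= u <= 1.
  by rewrite /u ler_pdivrMr // ler_pdivlMr //; apply/andP; split; nra.
have u3 : 0 <= 1 - u ^+ 2 by nra.
pose v := Num.sqrt (1 - u ^+ 2).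
have v2 : v ^+ 2 = 1 - u ^+ 2 by rewrite sqr_sqrtr.
exists (flat_point 0 0), (flat_point P 0), (flat_point (Q * u) (Q * v)).
rewrite /sqdist /=; split; first ring.
  transitivity (P ^+ 2 - 2 * P * Q * u + Q ^+ 2 * (u ^+ 2 + v ^+ 2)).
    by ring.
  by rewrite v2 /u; field; rewrite !gt_eqF.
transitivity (Q ^+ 2 * (u ^+ 2 + v ^+ 2)); first ring.
by rewrite v2; ring.
Qed.

Lemma flat_comparison (P Q E : R) : 0 < P -> 0 < Q -> 0 < E ->
  `|P - Q| <= E -> E <= P + Q ->
  sharp_comparison_triangle kappa P Q E.
Proof.
move=> P0 Q0 E0 PQE EPQ.
have [c [a [d [hca had hdc]]]] := flat_vertices P0 Q0 PQE EPQ.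
have [g0 [g00 g0P gg0 stew]] := flat_geodesic P0 hca.
have [g1 [g10 g1E gg1 _]] := flat_geodesic E0 had.
have [g2 [g20 g2Q gg2 _]] := flat_geodesic Q0 hdc.
exists c, a, d, [set g0 t | t in [set t | 0 <= t <= P]]%classic,
  [set g1 t | t in [set t | 0 <= t <= E]]%classic,
  [set g2 t | t in [set t | 0 <= t <= Q]]%classic.
split; first by split; [exists P, g0|exists E, g1|exists Q, g2].
split.
- by rewrite flat_distE hca sqrtr_sqr gtr0_norm.
- by rewrite flat_distE had sqrtr_sqr gtr0_norm.
- by rewrite flat_distE hdc sqrtr_sqr gtr0_norm.
move=> beta /andP[beta0 betaP]; exists (g0 beta).
have := stew beta d; rewrite had.
have -> : sqdist (val c) (val d) = Q ^+ 2 by rewrite -hdc /sqdist; ring.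
move=> hb; split.
- by exists beta; rewrite //= beta0.
- have -> : model_dist c (g0 beta) = `|0 - beta|.
    by rewrite -g00; apply: gg0.2; rewrite ?lexx ?beta0 //= ltW.
  by rewrite sub0r normrN ger0_norm.
- move=> hE hQ; rewrite flat_distE.
  suff -> : sqdist (val (g0 beta)) (val d) = 0 by rewrite sqrtr0.
  by apply: (mulfI (lt0r_neq0 P0)); rewrite hb hE hQ; ring.
- move=> beta1 hE; rewrite flat_distE.
  have bQ : 0 < beta + Q by lra.
  rewrite -(gtr0_norm bQ) -sqrtr_sqr ltr_sqrt ?exprn_gt0 //.
  rewrite -(ltr_pM2l P0) hb.
  have h : 0 < (P + Q - E) * (P + Q + E) by apply: mulr_gt0; lra.
  have := mulr_gt0 beta1 h; lra.
Qed.

End FlatModel.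

(** * Metric consequences of the comparison inequality *)

Section Segments.
Context {R : realType} {T : Type} {d : T -> T -> R}.

Lemma geodesic_segment_dist x y (S : set T) : geodesic_segment d x y S ->
  d x x = 0 /\ S x.
Proof.
move=> [c [g [[c0 hg] <- _ ->]]]; split.
  by rewrite hg ?lexx // subrr normr0.
by exists 0; rewrite //= lexx.
Qed.

Lemma triangle_of_segments x y z (S0 S1 S2 : set T) :
  geodesic_segment d x y S0 -> geodesic_segment d y z S1 ->
  geodesic_segment d z x S2 ->
  exists D : geodesic_triangle d,
    (forall i, vertex D i = tnth [tuple x; y; z] i) /\
    (forall i, side D i = tnth [tuple S0; S1; S2] i).
Proof.
move=> h0 h1 h2.
have h i : geodesic_segment d (tnth [tuple x; y; z] i)
    (tnth [tuple x; y; z] (i + 1)) (tnth [tuple S0; S1; S2] i).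
  by case: i => [[|[|[|//]]] hi]; [exact: h0|exact: h1|exact: h2].
by exists (GeodesicTriangle h).
Qed.

End Segments.

Section MetricSpace.
Context {R : realType} {X : metricType R}.

(** Concatenating geodesics from [x] to [y] and from [y] to [z] gives a geodesic
    because the triangle inequality from [x] to [z] leaves no slack. *)
Lemma concat_segment (x y z : X) : geodesic_space X ->
  mdist x z = mdist x y + mdist y z ->
  exists S, geodesic_segment (@mdist R X) x z S /\ S y.
Proof.
move=> geoX hxyz.
have [_ [c1 [g1 [[c10 hg1] g10 g1c _]]]] := geoX x y.
have [_ [c2 [g2 [[c20 hg2] g20 g2c _]]]] := geoX y z.
have d1 : mdist x y = c1.
  by rewrite -g10 -g1c hg1 ?lexx ?c10 // sub0r normrN ger0_norm.
have d2 : mdist y z = c2.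
  by rewrite -g20 -g2c hg2 ?lexx ?c20 // sub0r normrN ger0_norm.
pose g t := if t <= c1 then g1 t else g2 (t - c1).
have gD s t : 0 <= s -> s <= t -> t <= c1 + c2 -> mdist (g s) (g t) = t - s.
  move=> s0 st tc; rewrite /g.
  case: (leP t c1) => tc1; case: (leP s c1) => sc1; try lra.
  - rewrite hg1; [|by rewrite s0 sc1|by rewrite tc1 (le_trans s0)].
    by rewrite distrC ger0_norm // subr_ge0.
  - have e1 : mdist x (g1 s) = s.
      by rewrite -g10 hg1 ?lexx ?s0 ?c10 // sub0r normrN ger0_norm.
    have e2 : mdist (g1 s) y = c1 - s.
      by rewrite -g1c hg1 ?lexx ?s0 ?c10 // distrC ger0_norm //; lra.
    have e3 : mdist y (g2 (t - c1)) = t - c1.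
      rewrite -g20 hg2; [|by rewrite lexx c20|by apply/andP; split; lra].
      by rewrite sub0r normrN ger0_norm // subr_ge0 ltW.
    have e4 : mdist (g2 (t - c1)) z = c2 - (t - c1).
      rewrite -g2c hg2; [|by apply/andP; split; lra|by rewrite lexx c20].
      by rewrite distrC ger0_norm //; lra.
    have := metric_triangle x (g1 s) z.
    have := metric_triangle (g1 s) (g2 (t - c1)) z.
    have := metric_triangle (g1 s) y (g2 (t - c1)).
    lra.
  - rewrite hg2; [|by apply/andP; split; lra|by apply/andP; split; lra].
    have -> : s - c1 - (t - c1) = - (t - s) by ring.
    by rewrite normrN ger0_norm // subr_ge0.
exists [set g t | t in [set t | 0 <= t <= c1 + c2]]%classic; split; last first.
  by exists c1; rewrite /= ?c10 ?lerDl // /g lexx.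
exists (c1 + c2), g; split=> //.
- split; first by rewrite addr_ge0.
  move=> s t /andP[s0 sc] /andP[t0 tc]; case: (leP s t) => st.
    by rewrite gD // distrC ger0_norm // subr_ge0.
  by rewrite metric_sym gD // ?ger0_norm ?subr_ge0 // ltW.
- by rewrite /g c10.
- rewrite /g; case: leP => h; last by rewrite addrAC subrr add0r.
  have c20' : c2 = 0 by lra.
  by rewrite c20' addr0 g1c -g20 -g2c c20'.
Qed.

Lemma geodesic_point (a b : X) (eps : R) : geodesic_space X ->
  0 <= eps <= mdist a b ->
  exists m, mdist a m = eps /\ mdist m b = mdist a b - eps.
Proof.
move=> geoX /andP[e0 eab].
have [_ [c [g [[c0 hg] g0 gc _]]]] := geoX a b.
have dc : mdist a b = c.
  by rewrite -g0 -gc hg ?lexx ?c0 // sub0r normrN ger0_norm.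
exists (g eps); rewrite dc; split.
  by rewrite -g0 hg ?lexx ?c0 ?e0 -?dc //= sub0r normrN ger0_norm.
by rewrite -gc hg ?lexx ?c0 ?e0 -?dc //= distrC ger0_norm // subr_ge0.
Qed.

Context (kappa : R).

Lemma sharp_comparison_triangle_exists (P Q E : R) : 0 < P -> 0 < Q -> 0 < E ->
  `|P - Q| <= E -> E <= P + Q -> ((P + Q)%:E < model_diam kappa)%E ->
  sharp_comparison_triangle kappa P Q E.
Proof.
move=> P0 Q0 E0 PQE EPQ hdiam.
have [k0|k0] := eqVneq kappa 0; first exact: flat_comparison.
exact: curved_comparison.
Qed.

Hypotheses (geoX : geodesic_space X) (catX : CAT kappa X).

(** The comparison inequality for [b] on the side [c a] and the opposite vertex
    [d], in the two extreme cases of [sharp_comparison_triangle]. *)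
Lemma CAT_cevian (a b c d : X) : c != a -> c != d -> a != d ->
  mdist c a = mdist c b + mdist b a ->
  ((mdist c a + mdist c d)%:E < model_diam kappa)%E ->
  (mdist a d = mdist c a - mdist c d -> mdist c b = mdist c d -> b = d) /\
  (c != b -> mdist b d = mdist c b + mdist c d ->
   mdist a d = mdist c a + mdist c d).
Proof.
move=> ca cd ad cba hdiam.
have P0 : 0 < mdist c a by rewrite mdist_gt0.
have Q0 : 0 < mdist c d by rewrite mdist_gt0.
have E0 : 0 < mdist a d by rewrite mdist_gt0.
have t1 := metric_triangle a c d; rewrite (metric_sym a c) in t1.
have PQE : `|mdist c a - mdist c d| <= mdist a d.
  have := metric_triangle c a d; have := metric_triangle c d a.
  by rewrite (metric_sym d a) ler_norml => h1 h2; apply/andP; split; lra.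
have [c' [a' [d' [S0' [S1' [S2' [[s0' s1' s2'] [ca' ad' dc' hb]]]]]]]] :=
  sharp_comparison_triangle_exists P0 Q0 E0 PQE t1 hdiam.
have bI : 0 <= mdist c b <= mdist c a by rewrite mdist_ge0 cba lerDl mdist_ge0.
have [b' [Sb' cb' hb1 hb2]] := hb _ bI.
have [S0 [s0 Sb]] := concat_segment geoX cba.
have [S1 s1] := geoX a d; have [S2 s2] := geoX d c.
have [D [Dv Ds]] := triangle_of_segments s0 s1 s2.
have [D' [Dv' Ds']] := triangle_of_segments s0' s1' s2'.
(* The third side is at most the sum of the other two, so the perimeter is less
   than twice the diameter. *)
have small : small_triangle kappa D.
  rewrite /small_triangle !big_ord_recl big_ord0 addr0 /side_length !Dv.
  rewrite !(tnth_nth c) /=.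
  move: hdiam; rewrite /model_diam (metric_sym d c); case: ifP => _ hdiam.
    by rewrite -EFinM lte_fin; move: hdiam; rewrite lte_fin; lra.
  by rewrite mulry gtr0_sg // mul1e ltry.
have comp : comparison_triangle D D'.
  move=> i; rewrite /side_length !Dv !Dv'.
  rewrite !(tnth_nth c) !(tnth_nth c').
  by case: i => [[|[|[|//]]] hi] /=; rewrite // metric_sym.
have cpb : comparison_point D D' b b'.
  by exists 0; rewrite Ds Ds' Dv Dv'.
have cpd : comparison_point D D' d d'.
  exists (inord 2); rewrite Ds Ds' Dv Dv' !(tnth_nth c) !(tnth_nth c').
  rewrite !(tnth_nth S0) !(tnth_nth S0') inordK //=.
  have [d0 Sd] := geodesic_segment_dist s2.
  have [d0' Sd'] := geodesic_segment_dist s2'.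
  by rewrite d0 d0'.
have key := catX small comp cpb cpd.
split=> [hE hQ|cb hbd].
  apply/eqP; rewrite -[_ == _]negbK -mdist_gt0 -leNgt.
  by rewrite (le_trans key) // hb1.
apply/eqP; rewrite eq_le t1 leNgt /=; apply/negP => hlt.
have := hb2 _ hlt; rewrite mdist_gt0 => /(_ cb).
by rewrite -hbd ltNge key.
Qed.

(** Apply [CAT_cevian] to the degenerate triangle [a b q]: its comparison
    triangle has angle 0 at [a]. *)
Lemma geodesic_point_unique (a b p q : X) :
  0 < mdist a p < mdist a b -> mdist a q = mdist a p ->
  mdist p b = mdist a b - mdist a p -> mdist q b = mdist a b - mdist a p ->
  ((mdist a b + mdist a p)%:E < model_diam kappa)%E -> p = q.
Proof.
move=> /andP[h1 h2] aq pb qb hdiam.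
apply: (proj1 (@CAT_cevian b p a q _ _ _ _ _)).
- by rewrite -mdist_gt0; lra.
- by rewrite -mdist_gt0; lra.
- by rewrite -mdist_gt0 metric_sym; lra.
- by rewrite pb; ring.
- by rewrite aq.
- by rewrite metric_sym qb aq.
- by rewrite aq.
Qed.

(** In the triangle [c a d], the point [b] lies on the side [c a] and
    [d(b, d) = d(b, c) + d(c, d)], which forces the angle [pi] at [c]. *)
Lemma no_4_cut (a b c d : X) : b != c ->
  mdist a c = mdist a b + mdist b c -> mdist b d = mdist b c + mdist c d ->
  ((mdist a b + mdist b c + mdist c d)%:E < model_diam kappa)%E ->
  mdist a d = mdist a b + mdist b c + mdist c d.
Proof.
move=> bc abc bcd hdiam.
have bc0 : 0 < mdist b c by rewrite mdist_gt0.
have [<-|cd] := eqVneq c d; first by rewrite abc mdistxx addr0.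
have ab0 := mdist_ge0 a b.
have cd0 : 0 < mdist c d by rewrite mdist_gt0.
have ca : c != a by rewrite -mdist_gt0 metric_sym; lra.
(* If d = a, the two hypotheses give d(b, c) = 0. *)
have ad : a != d.
  apply: contraTneq (cd0) => had; move: bcd abc.
  by rewrite -had (metric_sym b a) (metric_sym c a); lra.
have cba : mdist c a = mdist c b + mdist b a.
  by rewrite metric_sym abc addrC (metric_sym a b) (metric_sym b c).
rewrite (proj2 (@CAT_cevian a b c d ca cd ad cba _)).
- by rewrite (metric_sym c a) abc.
- by rewrite (metric_sym c a) abc.
- by rewrite eq_sym.
- by rewrite bcd (metric_sym b c).
Qed.

End MetricSpace.

(** * Contraction by insertion *)

Lemma freeg_additive_eq0 (K : choiceType) (M : zmodType)
    (F : {freeg K / int} -> M) (c : {freeg K / int}) :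
  zmod_morphism F -> (forall x, x \in dom c -> F << x >> = 0) -> F c = 0.
Proof.
move=> addF F0.
pose G : {additive {freeg K / int} -> M} :=
  HB.pack F (GRing.isZmodMorphism.Build _ _ F addF).
rewrite -[c]freeg_sumE -[F]/(G : _ -> _) raddf_sum big_seq big1 // => x xc.
rewrite -[coeff x c]intz -freegU_mulz raddfMz.
by rewrite [X in X *~ _](F0 x xc) mul0rz.
Qed.

Section Insertion.
Context {R : realType} {X : metricType R}.
Variables (l eps : R) (pt : X -> X -> X).

Local Notation MC n := {freeg (chain X l n) / int}.

(** For [n = 0] the index 1 is out of range and [inord 1] is 0; [insertion] then
    makes sense in degree 0 too, where the faces of 1-chains would lie. *)
Definition insert_pt n (x : {ffun 'I_n.+1 -> X}) : {ffun 'I_n.+2 -> X} :=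
  [ffun j : 'I_n.+2 =>
    if (j : nat) is j'.+1 then
      if j' is 0 then pt (x (inord 0)) (x (inord 1)) else x (inord j')
    else x (inord 0)].

Definition insertion n : MC n -> MC n.+1 :=
  fglift (fun x : chain X l n => of_tuple l (insert_pt x)).

Lemma insertion_additive n : zmod_morphism (@insertion n).
Proof. exact: lift_is_additive. Qed.

HB.instance Definition _ n :=
  GRing.isZmodMorphism.Build (MC n) (MC n.+1) (@insertion n)
    (@insertion_additive n).

(** [of_tuple] is 0 on the tuples that are not proper of length [l]; inserting a
    point need not preserve this. *)
Lemma insertion_of_tuple n (x : {ffun 'I_n.+1 -> X}) :
  insertion (of_tuple l x) =
  if proper_of_length l x then of_tuple l (insert_pt x) else 0.
Proof.
rewrite {1}/of_tuple; case: insubP => [y hx e|/negbTE hx] /=.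
  by rewrite hx /insertion liftU scale1r -e.
by rewrite hx raddf0.
Qed.

Lemma insert_pt_inord n (x : {ffun 'I_n.+1 -> X}) j : (j <= n.+1)%N ->
  insert_pt x (inord j) =
    if j is j'.+1 then
      if j' is 0 then pt (x (inord 0)) (x (inord 1)) else x (inord j')
    else x (inord 0).
Proof. by move=> hj; rewrite ffunE inordK. Qed.

Lemma omit_insert_pt n (x : {ffun 'I_n.+1 -> X}) : omit 1 (insert_pt x) = x.
Proof.
apply/ffunP => j; have hj := ltn_ord j; rewrite -[j]inord_val omit_inord //.
rewrite insert_pt_inord; last by rewrite /bump; lia.
by case: (j : nat) => //.
Qed.

(** The index [bump i.+1 1] is that of the point which comes second once the
    point of index [i.+1] is deleted: 2 if [i = 0], and 1 otherwise. *)
Lemma omit_insert_ptS n (x : {ffun 'I_n.+2 -> X}) i : (i < n)%N ->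
  pt (x (inord 0)) (x (inord 1)) = pt (x (inord 0)) (x (inord (bump i.+1 1))) ->
  omit i.+2 (insert_pt x) = insert_pt (omit i.+1 x).
Proof.
move=> hi hpt; apply/ffunP => j; have hj := ltn_ord j.
rewrite -[j]inord_val omit_inord ?insert_pt_inord //; try (rewrite ?/bump; lia).
case: (j : nat) hj => [|[|k]] hk.
- by rewrite omit_inord //; lia.
- by rewrite !omit_inord //; lia.
- by rewrite omit_inord ?bumpS //; lia.
Qed.

Hypothesis eps_gt0 : 0 < eps.
Hypothesis pt_spec : forall a b, eps < mdist a b ->
  mdist a (pt a b) = eps /\ mdist (pt a b) b = mdist a b - eps.
Hypothesis pt_unique : forall a b p, eps < mdist a b -> mdist a b <= l ->
  mdist a p = eps -> mdist p b = mdist a b - eps -> p = pt a b.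
Hypothesis no_cut : forall a b c d : X, b != c ->
  mdist a c = mdist a b + mdist b c -> mdist b d = mdist b c + mdist c d ->
  mdist a b + mdist b c + mdist c d <= l ->
  mdist a d = mdist a b + mdist b c + mdist c d.

Lemma insert_pt_proper n (x : chain X l n.+1) :
  eps < mdist (x (inord 0)) (x (inord 1)) -> proper_of_length l (insert_pt x).
Proof.
move=> hx; have [h1 h2] := pt_spec hx.
have hl := @omit_length _ _ n.+1 1 (insert_pt x) isT.
rewrite omit_insert_pt chain_length !insert_pt_inord //= h1 h2 in hl.
apply/andP; split; last by apply/eqP; lra.
apply/forallP => -[[|[|j]] hj] /=; rewrite !insert_pt_inord //.
- by rewrite -mdist_gt0 h1.
- by rewrite -mdist_gt0 h2 subr_gt0.
- by apply: chain_proper; lia.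
- by lia.
Qed.

Lemma first_two_steps n (x : {ffun 'I_n.+3 -> X}) :
  mdist (x (inord 0)) (x (inord 1)) + mdist (x (inord 1)) (x (inord 2))
    <= tuple_length x.
Proof.
rewrite tuple_length_nat big_ltn // (@big_ltn _ _ _ 1) // addrA lerDl.
by apply: sumr_ge0 => i _; exact: mdist_ge0.
Qed.

(** Unless the first step changes, i.e. [i = 0], both sides delete the same
    point under the same condition.  For [i = 0], [no_cut] makes the conditions agree
    and [pt_unique] makes the inserted points agree. *)
Lemma insertion_face n (x : chain X l n.+1) i : (i < n)%N ->
  eps < mdist (x (inord 0)) (x (inord 1)) ->
  of_tuple l (omit i.+2 (insert_pt x)) = insertion (of_tuple l (omit i.+1 x)).
Proof.
move=> hi hx; rewrite insertion_of_tuple.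
pose y : chain X l n.+2 := Chain (insert_pt_proper hx).
have hy := @omit_proper _ _ _ _ i.+2 y; have hx' := @omit_proper _ _ _ _ i.+1 x.
rewrite -hx'; last by lia.
have yP : proper_of_length l (omit i.+2 (insert_pt x)) =
  strictly_between (insert_pt x (inord i.+1)) (insert_pt x (inord i.+2))
    (insert_pt x (inord i.+3)) by rewrite -hy //=; lia.
rewrite !insert_pt_inord in yP; try lia.
have P0 : proper_of_length l (omit i.+2 (insert_pt x)) = false ->
  of_tuple l (omit i.+2 (insert_pt x)) = 0.
  by move=> h; rewrite /of_tuple insubF.
case: i hi yP P0 {y hy hx'} => [|i] hi /= yP P0; last first.
  case: ifP yP => hb yP; last exact: P0.
  by rewrite omit_insert_ptS //.
case: n x hx hi yP P0 => // n x hx hi yP P0.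
have [h1 h2] := pt_spec hx.
have hlen := first_two_steps x; rewrite chain_length in hlen.
have d12 := mdist_ge0 (x (inord 1)) (x (inord 2)).
case: ifP => [/and3P[/eqP hd _ _]|hb].
  rewrite omit_insert_ptS //; apply: pt_unique => //.
  - by rewrite hd; lra.
  - by rewrite hd.
  - apply/eqP; rewrite eq_le; apply/andP; split.
      have := metric_triangle (pt (x (inord 0)) (x (inord 1)))
        (x (inord 1)) (x (inord 2)).
      by rewrite /bump /= hd; lra.
    have := metric_triangle (x (inord 0)) (pt (x (inord 0)) (x (inord 1)))
      (x (inord 2)).
    by rewrite /bump /=; lra.
apply: P0; rewrite yP; apply: contraFF hb => /and3P[/eqP hd hne1 hne2].
have x01 : x (inord 1) != x (inord 0).
  by rewrite eq_sym; apply: chain_proper.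
rewrite /strictly_between x01 hne2 !andbT; apply/eqP.
rewrite (no_cut _ _ hd) // ?h1 ?h2.
- ring.
- by rewrite eq_sym.
- ring.
- by apply: le_trans hlen; lra.
Qed.

Lemma insertion_homotopy n (x : chain X l n.+1) :
  eps < mdist (x (inord 0)) (x (inord 1)) ->
  Defs.diff (insertion << x >>) + << x >> + insertion (Defs.diff << x >>) = 0.
Proof.
move=> hx.
have chainE m (y : chain X l m) : of_tuple l y = << y >>.
  by rewrite /of_tuple valK.
pose y : chain X l n.+2 := Chain (insert_pt_proper hx).
have -> : insertion << x >> = << y >>.
  by rewrite -(chainE _ y) /insertion liftU scale1r.
rewrite !diff_basis /= big_ltn // omit_insert_pt chainE.
rewrite expr1 scaleN1r [_ + << x >>]addrAC addNr add0r.
(* Deleting position i + 2 after the insertion cancels, with the opposite sign,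
   inserting after the deletion of position i + 1. *)
rewrite big_add1 raddf_sum /= -big_split /= big_nat.
rewrite big1 // => -[//|i] /andP[_ hi].
have -> : (-1) ^+ i.+1 *: of_tuple l (omit i.+1 x) =
          of_tuple l (omit i.+1 x) *~ (-1) ^+ i.+1.
  by rewrite -scaler_int intz.
rewrite raddfMz -[X in _ + X *~ _](insertion_face (hi : (i < n)%N) hx).
rewrite -scaler_int intz -scalerDl.
by rewrite exprS mulN1r addNr scale0r.
Qed.

Lemma insertion_cycle n (c : MC n.+1) :
  (forall x, x \in dom c -> eps < mdist (x (inord 0)) (x (inord 1))) ->
  Defs.diff c = 0 -> exists b : MC n.+2, Defs.diff b = c.
Proof.
move=> hc c0.
have : Defs.diff (insertion c) + c + insertion (Defs.diff c) = 0.
  apply: (@freeg_additive_eq0 _ _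
    (fun c => Defs.diff (insertion c) + c + insertion (Defs.diff c))).
    move=> u v /=; rewrite !raddfB /= [X in X + _]addrACA -opprD.
    by rewrite addrACA -opprD.
  by move=> x xc; apply: insertion_homotopy; apply: hc.
rewrite c0 raddf0 addr0 => h.
exists (- insertion c); rewrite raddfN.
by apply/eqP; rewrite eqr_oppLR -addr_eq0 h.
Qed.

End Insertion.

(** * Vanishing *)

Lemma positive_lower_bound (R : realType) (T : eqType) (s : seq T) (f : T -> R)
    (delta : R) : 0 < delta -> (forall x, x \in s -> 0 < f x) ->
  exists eps, [/\ 0 < eps, eps < delta & forall x, x \in s -> eps < f x].
Proof.
move=> delta_gt0; elim: s => [|y s IHs] f_gt0.
  by exists (delta / 2); split; [lra|lra|].
have [|eps [e0 ed ef]] := IHs.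
  by move=> x xs; apply: f_gt0; rewrite in_cons xs orbT.
have fy : 0 < f y by apply: f_gt0; rewrite mem_head.
exists (Num.min eps (f y / 2)); split.
- by rewrite lt_min e0 divr_gt0.
- by rewrite gt_min ed.
- move=> x; rewrite in_cons gt_min => /predU1P[->|xs]; last by rewrite ef.
  by apply/orP; right; lra.
Qed.

(** Room for a small [eps] is needed because [geodesic_point_unique] compares a
    triangle with sides of lengths up to [l] and [eps] at one vertex. *)
Lemma diam_margin (R : realType) (kappa l : R) : (l%:E < model_diam kappa)%E ->
  exists delta, 0 < delta /\
    forall eps, eps < delta -> ((l + eps)%:E < model_diam kappa)%E.
Proof.
rewrite /model_diam; case: ifP => _; last first.
  by exists 1; split=> // eps _; exact: ltry.
rewrite lte_fin => hl; exists (pi / Num.sqrt kappa - l).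
by split=> [|eps]; rewrite ?subr_gt0 // lte_fin; lra.
Qed.

Theorem corollary4p6 (R : realType) (kappa : R) (X : metricType R)
    (X_geodesic : geodesic_space X) (X_CAT : CAT kappa X)
    (n : nat) (n_gt0 : (0 < n)%N)
    (l : R) (l_gt0 : 0 < l) (l_lt : (l%:E < model_diam kappa)%E) :
  forall x : MH X l n, x = 0.
Proof.
case: n n_gt0 => // n _; apply/MH_eq0 => c dc.
have [delta [delta_gt0 delta_diam]] := diam_margin l_lt.
have first_step_gt0 (x : chain X l n.+1) : x \in dom c ->
    0 < mdist (x (inord 0)) (x (inord 1)).
  by move=> _; rewrite mdist_gt0; apply: chain_proper.
have [eps [eps_gt0 eps_delta eps_step]] :=
  positive_lower_bound delta_gt0 first_step_gt0.
have l_eps : ((l + eps)%:E < model_diam kappa)%E by apply: delta_diam.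
pose pt (a b : X) := xget a
  [set m : X | mdist a m = eps /\ mdist m b = mdist a b - eps]%classic.
have pt_spec a b : eps < mdist a b ->
    mdist a (pt a b) = eps /\ mdist (pt a b) b = mdist a b - eps.
  move=> ab; rewrite /pt.
  have [|m hm] := @geodesic_point _ _ a b eps X_geodesic.
    by rewrite (ltW eps_gt0) ltW.
  by case: xgetP => [y _ hy //|/(_ m)]; case.
apply: (insertion_cycle eps_gt0 pt_spec) eps_step dc.
- move=> a b p ab abl ap pb; have [h1 h2] := pt_spec _ _ ab.
  apply: (geodesic_point_unique X_geodesic X_CAT (a := a) (b := b)).
  + by rewrite ap eps_gt0.
  + by rewrite ap.
  + by rewrite ap.
  + by rewrite ap.
  + by rewrite ap; apply: le_diam l_eps; rewrite lerD2r.
- move=> a b c' d bc abc bcd habcd.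
  apply: (no_4_cut X_geodesic X_CAT) => //.
  exact: le_diam l_lt.
Qed.
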